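(* Let $t\in\mathbb R\setminus\{0\}$ and let $\alpha\in\mathbb H_t$ with $\|\alpha\|_{op}<1$. The operator $M_{b_\alpha}:f\mapsto b_\alpha\star f$ of $\star$-multiplication by the Blaschke factor $b_\alpha$ on the left is a continuous isometry from the Krein space $\mathbf H_{2,\circledast}^t$ into itself.
   Context: For $t\in\mathbb R\setminus\{0\}$, $\mathbb H_t$ is the real algebra (matrix addition and multiplication) of matrices $q_t=\begin{pmatrix}a&tb\\ \overline b&\overline a\end{pmatrix}$, $a,b\in\mathbb C$; $q_t^{\circledast}=\begin{pmatrix}\overline a&-tb\\ -\overline b&a\end{pmatrix}$; $\|q_t\|_{op}$ is the operator norm of the matrix on $\mathbb C^2$ and $\|q_t\|_E=\sqrt{|a|^2+|t||b|^2}$. $\mathbf H_2^t$ is the real vector space of power series $f(q_t)=\sum_{n=0}^\infty q_t^n\alpha_n$, $\alpha_n\in\mathbb H_t$, with $\sum_n\|\alpha_n\|_E^2<\infty$, with the Hilbert space topology given by this norm; $\mathbf H_{2,\circledast}^t$ is $\mathbf H_2^t$ endowed with the real symmetric form $[f,g]_\circledast=\sum_{n=0}^\infty{\rm Tr}\,(g_n^{\circledast}f_n)$ for $f=\sum q_t^nf_n$, $g=\sum q_t^ng_n$, which makes it a real Krein space. Isometry means preservation of this form. The $\star$-product of power series is $\left(\sum q_t^n\alpha_n\right)\star\left(\sum q_t^n\beta_n\right)=\sum_n q_t^n\sum_{k=0}^n\alpha_{n-k}\beta_k$, and $S^{-\star}$ is the inverse of $S$ for $\star$. For $\|\alpha\|_{op}<1$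 the Blaschke factor is the power series $b_\alpha(q_t)=(q_t-\alpha)\star(1-q_t\alpha^{\circledast})^{-\star}$. *)

(* Defs.v *)
From HB Require Import structures.
From mathcomp Require Import all_boot all_order all_algebra.
From mathcomp Require Import all_classical all_reals all_analysis.
From mathcomp Require Import complex.
From mathcomp Require Import ring lra.

Set Implicit Arguments.
Unset Strict Implicit.
Unset Printing Implicit Defensive.

Import Order.TTheory GRing.Theory Num.Theory.
Import numFieldNormedType.Exports Normc.
Local Open Scope classical_set_scope.
Local Open Scope ring_scope.
Local Open Scope complex_scope.

Section OperatorNorm.
Variables (R : realType) (n : nat).

Definition l2norm (v : 'cV[R[i]]_n) : R :=
  Num.sqrt (\sum_(i < n) normc (v i ord0) ^+ 2).

Definition opnorm (A : 'M[R[i]]_n) : R :=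
  sup [set l2norm (A *m v) | v in [set v | l2norm v <= 1]].

End OperatorNorm.

Section ScaledQuaternions.
Variables (R : realType) (t : R).
Local Notation M2 := 'M[R[i]]_2.

Definition qmx (a b : R[i]) : M2 :=
  \matrix_(i < 2, j < 2)
    if i == 0 then (if j == 0 then a else t%:C * b)
    else (if j == 0 then conjc b else conjc a).

Let conjD (x y : R[i]) : conjc (x + y) = conjc x + conjc y.
Proof. exact: rmorphD. Qed.
Let conjM (x y : R[i]) : conjc (x * y) = conjc x * conjc y.
Proof. exact: rmorphM. Qed.

(* A matrix q is in Ht iff it equals qmx a b for some a and b (see is_HtP), in
   which case a and b are read off its first column. *)
Definition is_Ht : {pred M2} := [pred q : M2 | q == qmx (q 0 0) (conjc (q 1 0))].

Lemma qmx_is_Ht a b : qmx a b \in is_Ht.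
Proof. by rewrite inE; apply/eqP; congr qmx; rewrite mxE //= conjcK. Qed.

Lemma is_HtP (q : M2) : reflect (exists a b, q = qmx a b) (q \in is_Ht).
Proof.
apply: (iffP idP) => [/eqP ->|[a [b ->]]]; last exact: qmx_is_Ht.
by exists (q 0 0), (conjc (q 1 0)).
Qed.

Lemma qmxB a b c d : qmx a b - qmx c d = qmx (a - c) (b - d).
Proof.
apply/matrixP => i j; rewrite !mxE.
by case: ifP => _; case: ifP => _; rewrite ?rmorphB// mulrBr.
Qed.

Lemma qmxM a b c d :
  qmx a b * qmx c d = qmx (a * c + t%:C * b * conjc d) (a * d + b * conjc c).
Proof.
apply/matrixP => i j; rewrite !mxE big_ord_recl big_ord1 !mxE /=.
case: ifP => _; case: ifP => _;
  rewrite ?conjD ?conjM ?conjcK ?conjc_real //; ring.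
Qed.

Lemma qmx1 : 1 = qmx 1 0.
Proof.
apply/matrixP => i j; rewrite !mxE rmorph1 rmorph0 mulr0.
by case: i => -[|[|i]] ?; case: j => -[|[|j]] ?.
Qed.

Lemma qmxZ (r : R) a b : r%:C *: qmx a b = qmx (r%:C * a) (r%:C * b).
Proof.
apply/matrixP => i j; rewrite !mxE.
by case: ifP => _; case: ifP => _;
  rewrite ?conjM ?conjc_real // mulrCA.
Qed.

Fact is_Ht_subring : subring_closed is_Ht.
Proof.
split=> [|x y /is_HtP[a [b ->]] /is_HtP[c [d ->]]
         |x y /is_HtP[a [b ->]] /is_HtP[c [d ->]]].
- by rewrite qmx1 qmx_is_Ht.
- by rewrite qmxB qmx_is_Ht.
- by rewrite qmxM qmx_is_Ht.
Qed.
HB.instance Definition _ := GRing.isSubringClosed.Build M2 is_Ht is_Ht_subring.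

Record Ht := MkHt { Ht_mx :> M2; _ : Ht_mx \in is_Ht }.
HB.instance Definition _ := [isSub for Ht_mx].
HB.instance Definition _ := [Choice of Ht by <:].
HB.instance Definition _ := [SubChoice_isSubNzRing of Ht by <:].

Definition qt (a b : R[i]) : Ht := MkHt (qmx_is_Ht a b).
Definition qa (q : Ht) : R[i] := q 0 0.
Definition qb (q : Ht) : R[i] := conjc (q 1 0).

Lemma qtE (q : Ht) : q = qt (qa q) (qb q).
Proof. by apply/val_inj/eqP; case: q. Qed.

Fact Ht_scale_subproof (r : R) (q : Ht) : r%:C *: (q : M2) \in is_Ht.
Proof. by rewrite (qtE q) /= qmxZ qmx_is_Ht. Qed.
Definition Ht_scale (r : R) (q : Ht) : Ht := MkHt (Ht_scale_subproof r q).

Fact Ht_scaleA a b v : Ht_scale a (Ht_scale b v) = Ht_scale (a * b) v.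
Proof. by apply: val_inj; rewrite /= scalerA rmorphM. Qed.
Fact Ht_scale1 : left_id 1 Ht_scale.
Proof. by move=> v; apply: val_inj; rewrite /= rmorph1 scale1r. Qed.
Fact Ht_scaleDr : right_distributive Ht_scale +%R.
Proof. by move=> a u v; apply: val_inj; rewrite /= scalerDr. Qed.
Fact Ht_scaleDl v : {morph Ht_scale^~ v : a b / a + b}.
Proof. by move=> a b; apply: val_inj; rewrite /= rmorphD scalerDl. Qed.
HB.instance Definition _ := GRing.Zmodule_isLmodule.Build R Ht
  Ht_scaleA Ht_scale1 Ht_scaleDr Ht_scaleDl.

Fact Ht_scaleAl (k : R) (x y : Ht) : k *: (x * y) = (k *: x) * y.
Proof. by apply: val_inj; exact: scalerAl. Qed.
HB.instance Definition _ := GRing.Lmodule_isLalgebra.Build R Ht Ht_scaleAl.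
Fact Ht_scaleAr (k : R) (x y : Ht) : k *: (x * y) = x * (k *: y).
Proof. by apply: val_inj; exact: scalerAr. Qed.
HB.instance Definition _ := GRing.Lalgebra_isAlgebra.Build R Ht Ht_scaleAr.

Definition qadj (q : Ht) : Ht := qt (conjc (qa q)) (- qb q).

Definition normE (q : Ht) : R :=
  Num.sqrt (normc (qa q) ^+ 2 + `|t| * normc (qb q) ^+ 2).

(* The trace of an element of Ht is real, hence equal to its real part. *)
Definition qtr (q : Ht) : R := complex.Re (\tr q).

Lemma qtrE (q : Ht) : \tr q = (qtr q)%:C.
Proof.
rewrite /qtr (qtE q) /= /mxtrace big_ord_recl big_ord1 !mxE /=.
by case: (qa q) => x y; apply/eqP; rewrite eq_complex /= subrr !eqxx.
Qed.

(* The power series \sum_n q_t^n f_n is represented by its coefficients f. *)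
Definition pstar (f g : nat -> Ht) : nat -> Ht :=
  fun n => \sum_(k < n.+1) f (n - k)%N * g k.

Definition pconst (c : Ht) : nat -> Ht := fun n => if n == 0%N then c else 0.

(* The power series q_t c. *)
Definition plin (c : Ht) : nat -> Ht := fun n => if n == 1%N then c else 0.

Definition is_pstar_inv (S T : nat -> Ht) : Prop :=
  pstar S T = pconst 1 /\ pstar T S = pconst 1.

(* The default value is not used on Blaschke factors, see blaschke_invP. *)
Definition pstar_inv (S : nat -> Ht) : nat -> Ht :=
  xget (pconst 0) [set T | is_pstar_inv S T].

Definition blaschke (alpha : Ht) : nat -> Ht :=
  pstar (plin 1 - pconst alpha) (pstar_inv (pconst 1 - plin (qadj alpha))).

Lemma blaschke_invP (alpha : Ht) :
  is_pstar_inv (pconst 1 - plin (qadj alpha))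
               (pstar_inv (pconst 1 - plin (qadj alpha))).
Proof.
rewrite /pstar_inv; case: xgetP => // /(_ (fun n => qadj alpha ^+ n)) [].
set c := qadj alpha.
have E n : (pconst 1 - plin c) n = pconst 1 n - plin c n by [].
split; apply/funext => -[|n]; rewrite /pstar.
- by rewrite big_ord1 E /pconst /plin /= subr0 mulr1.
- rewrite big_ord_recr big_ord_recr big1 => [|i _] /=.
    rewrite !E subnn subSnn /pconst /plin /= subr0 !sub0r add0r mul1r.
    by rewrite mulNr -exprS addNr.
  rewrite subSn 1?ltnW// -subnSK// E.
  by rewrite /pconst /plin /= subrr mul0r.
- by rewrite big_ord1 E /pconst /plin /= subr0 mulr1.
- rewrite big_ord_recl big_ord_recl big1 => [|i _] /=.
    rewrite !E /pconst /plin /= subr0 sub0r addr0 mulr1 mulrN.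
    by rewrite /bump /= subn0 subSS subn0 -exprSr subrr.
  by rewrite E /pconst /plin /bump /= !add1n subrr mulr0.
Qed.

End ScaledQuaternions.

Section Norms.
Variables (R : realType) (t : R).
Implicit Types (x y : Ht t) (f g : nat -> Ht t).

Local Notation normE2 x := (normE x ^+ 2).

Lemma normE2E x : normE2 x = complex.Re (qa x) ^+ 2 + complex.Im (qa x) ^+ 2
  + `|t| * (complex.Re (qb x) ^+ 2 + complex.Im (qb x) ^+ 2).
Proof.
have nE (z : R[i]) : normc z ^+ 2 = complex.Re z ^+ 2 + complex.Im z ^+ 2.
  by case: z => a b /=; rewrite sqr_sqrtr// addr_ge0 ?sqr_ge0.
by rewrite /normE sqr_sqrtr ?nE// addr_ge0 ?mulr_ge0 ?addr_ge0 ?sqr_ge0.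
Qed.

Lemma normE2_ge0 x : 0 <= normE2 x. Proof. exact: sqr_ge0. Qed.

Lemma qaD x y : qa (x + y) = qa x + qa y. Proof. by rewrite /qa !mxE. Qed.
Lemma qbD x y : qb (x + y) = qb x + qb y.
Proof. by rewrite /qb !mxE rmorphD. Qed.
Lemma qaZ (r : R) x : qa (r *: x) = r%:C * qa x.
Proof. by rewrite /qa !mxE. Qed.
Lemma qbZ (r : R) x : qb (r *: x) = r%:C * qb x.
Proof. by rewrite /qb !mxE rmorphM; congr (_ * _); exact: conjc_real. Qed.

Lemma normE2Z (r : R) x : normE2 (r *: x) = r ^+ 2 * normE2 x.
Proof.
rewrite !normE2E qaZ qbZ; case: (qa x) (qb x) => a b [c d] /=.
ring.
Qed.

Lemma normE2D (l : R) x y : 0 < l ->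
  normE2 (x + y) <= (1 + l) * normE2 x + (1 + l^-1) * normE2 y.
Proof.
move=> l0; rewrite !normE2E qaD qbD.
case: (qa x) (qb x) (qa y) (qb y) => a1 a2 [a3 a4] [b1 b2] [b3 b4] /=.
have H (u v : R) : (u + v) ^+ 2 <= (1 + l) * u ^+ 2 + (1 + l^-1) * v ^+ 2.
  rewrite -subr_ge0.
  suff -> : (1 + l) * u ^+ 2 + (1 + l^-1) * v ^+ 2 - (u + v) ^+ 2
            = l * (u - l^-1 * v) ^+ 2.
    by apply: mulr_ge0; [exact: ltW | exact: sqr_ge0].
  by field; rewrite gt_eqF.
have := lerD (lerD (H a1 b1) (H a2 b2))
  (ler_wpM2l (normr_ge0 t) (lerD (H a3 b3) (H a4 b4))).
move/le_trans; apply; rewrite le_eqVlt; apply/orP; left; apply/eqP; ring.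
Qed.

Definition square_summable : {pred nat -> Ht t} :=
  mem [set f | cvgn (series (fun n => normE2 (f n)))].

Lemma square_summableP f :
  (f \in square_summable) = `[< cvgn (series (fun n => normE2 (f n))) >].
Proof. by []. Qed.

Fact square_summable_submod : submod_closed square_summable.
Proof.
split=> [|r f g]; rewrite !square_summableP.
  apply/asboolP.
  rewrite (_ : series _ = cst 0); first exact: is_cvg_cst.
  apply/funext => n; rewrite /series /= big1 // => i _.
  by have := @normE2Z 0 0; rewrite scale0r expr0n /= mul0r.
move=> /asboolP cf /asboolP cg; apply/asboolP.
have cf' := is_cvg_seriesZ (k := 2 * r ^+ 2) cf.
have cg' := is_cvg_seriesZ (k := 2) cg.
have := is_cvg_seriesD cf' cg'.
apply: series_le_cvg => n.
- exact: normE2_ge0.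
- apply: addr_ge0; apply: mulr_ge0 => //; do ?exact: sqr_ge0.
  by apply: mulr_ge0 => //; exact: sqr_ge0.
- have := @normE2D 1 (r *: f n) (g n) ltr01.
  by rewrite normE2Z invr1 mulrA.
Qed.
HB.instance Definition _ := GRing.isSubmodClosed.Build R (nat -> Ht t)
  square_summable square_summable_submod.

Definition normH2 f : R := Num.sqrt (limn (series (fun n => normE (f n) ^+ 2))).

(* The series converges on square-summable sequences, see krein_form_cvg. *)
Definition krein_form f g : R :=
  limn (series (fun n => qtr (qadj (g n) * f n))).

Local Notation Q f := (limn (series (fun n => normE2 (f n)))).

Lemma normE2_lim f n : f \in square_summable -> normE2 (f n) <= Q f.
Proof.
move=> /asboolP cf; apply: (@le_trans _ _ (series (fun n => normE2 (f n)) n.+1)).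
  by rewrite /series /= big_nat_recr//= lerDr sumr_ge0// => i _; exact: normE2_ge0.
apply: nondecreasing_cvgn_le => //.
by apply/nondecreasing_seqP => k; rewrite /series /= big_nat_recr//= lerDl normE2_ge0.
Qed.

Lemma lim_normE2_ge0 f : f \in square_summable -> 0 <= Q f.
Proof. by move=> /(normE2_lim 0); apply: le_trans; exact: normE2_ge0. Qed.

Lemma sqr_normH2 f : f \in square_summable -> normH2 f ^+ 2 = Q f.
Proof. by move=> sf; rewrite sqr_sqrtr// lim_normE2_ge0. Qed.

Let lim_seriesM (k : R) (u : R ^nat) : cvgn (series u) ->
  limn (series (k *: u)) = k * limn (series u).
Proof. exact: lim_seriesZ. Qed.

Lemma lim_normE2D (l : R) f g : 0 < l ->
  f \in square_summable -> g \in square_summable ->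
  Q (f + g) <= (1 + l) * Q f + (1 + l^-1) * Q g.
Proof.
move=> l0 sf sg.
have sfg : f + g \in square_summable by exact: rpredD.
move: sf sg sfg => /asboolP cf /asboolP cg /asboolP cfg.
rewrite -(lim_seriesM (1 + l) cf) -(lim_seriesM (1 + l^-1) cg).
rewrite -lim_seriesD; do ?exact: is_cvg_seriesZ.
apply: lim_series_le => //.
  by apply: is_cvg_seriesD; exact: is_cvg_seriesZ.
by move=> n; exact: normE2D.
Qed.

Lemma normH2D f g : f \in square_summable -> g \in square_summable ->
  normH2 (f + g) <= normH2 f + normH2 g.
Proof.
move=> sf sg; apply/ler_addgt0Pr => e e0.
set a := normH2 f; set b := normH2 g.
have e20 : 0 < e / 2 by rewrite divr_gt0.
have a0 : 0 < a + e / 2 by rewrite ltr_wpDl ?sqrtr_ge0.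
have b0 : 0 < b + e / 2 by rewrite ltr_wpDl ?sqrtr_ge0.
suff : Q (f + g) <= (a + b + e) ^+ 2.
  move=> /ler_wsqrtr/le_trans; apply.
  by rewrite sqrtr_sqr ger0_norm// !addr_ge0 ?sqrtr_ge0// ltW.
apply: (le_trans (lim_normE2D (divr_gt0 b0 a0) sf sg)).
rewrite -!sqr_normH2// -/a -/b.
have -> : (a + b + e) ^+ 2 =
  (1 + (b + e / 2) / (a + e / 2)) * (a + e / 2) ^+ 2 +
  (1 + ((b + e / 2) / (a + e / 2))^-1) * (b + e / 2) ^+ 2.
  have -> : a + b + e = (a + e / 2) + (b + e / 2) by field.
  move: (a + e / 2) (b + e / 2) a0 b0 => p q p0 q0.
  by field; rewrite ?gt_eqF.
apply: lerD; apply: ler_wpM2l.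
- by rewrite addr_ge0// ltW// divr_gt0.
- by rewrite ler_sqr ?nnegrE ?sqrtr_ge0 ?(ltW a0)// lerDl ltW.
- by rewrite addr_ge0// ltW// invr_gt0 divr_gt0.
- by rewrite ler_sqr ?nnegrE ?sqrtr_ge0 ?(ltW b0)// lerDl ltW.
Qed.

Lemma normH2Z (r : R) f : f \in square_summable ->
  normH2 (r *: f) = `|r| * normH2 f.
Proof.
move=> /asboolP cf; rewrite /normH2 -sqrtr_sqr -sqrtrM ?sqr_ge0//.
rewrite -(lim_seriesM (r ^+ 2) cf).
by congr (Num.sqrt (limn (series _))); apply/funext => n; exact: normE2Z.
Qed.

Lemma normH2_eq0 f : t != 0 -> f \in square_summable -> normH2 f = 0 -> f = 0.
Proof.
move=> t0 sf /eqP; rewrite sqrtr_eq0 => Qf0; apply/funext => n.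
have : normE2 (f n) <= 0 by exact: le_trans (normE2_lim n sf) Qf0.
have t_gt0 : 0 < `|t| by rewrite normr_gt0.
move: (f n) => x; rewrite normE2E => H.
rewrite (qtE x); case: (qa x) (qb x) H => a1 a2 [b1 b2] /= H.
have [p q] : 0 <= a1 ^+ 2 + a2 ^+ 2 /\ 0 <= b1 ^+ 2 + b2 ^+ 2.
  by split; apply: addr_ge0; exact: sqr_ge0.
have q' : 0 <= `|t| * (b1 ^+ 2 + b2 ^+ 2) by rewrite mulr_ge0.
have /eqP : a1 ^+ 2 + a2 ^+ 2 = 0 by lra.
rewrite paddr_eq0 ?sqr_ge0// !sqrf_eq0 => /andP[/eqP-> /eqP->].
have /eqP : `|t| * (b1 ^+ 2 + b2 ^+ 2) = 0 by lra.
rewrite mulf_eq0 (gt_eqF t_gt0)/= paddr_eq0 ?sqr_ge0// !sqrf_eq0.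
move=> /andP[/eqP-> /eqP->].
rewrite -[Complex 0 0]/(0 : R[i]); apply/val_inj/matrixP => i j; rewrite !mxE.
by case: ifP => _; case: ifP => _; rewrite ?mulr0 ?conjc0.
Qed.

Lemma qtr_qadjM x y : qtr (qadj y * x) =
  2 * (complex.Re (qa y) * complex.Re (qa x)
       + complex.Im (qa y) * complex.Im (qa x)
       - t * (complex.Re (qb y) * complex.Re (qb x)
              + complex.Im (qb y) * complex.Im (qb x))).
Proof.
rewrite {1}(qtE x) /qadj.
case: (qa x) (qb x) (qa y) (qb y) => a1 a2 [b1 b2] [c1 c2] [d1 d2].
rewrite /qtr /= qmxM /mxtrace big_ord_recl big_ord1 !mxE /=.
ring.
Qed.

Lemma krein_form_cvg f g : f \in square_summable -> g \in square_summable ->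
  cvgn (series (fun n => qtr (qadj (g n) * f n))).
Proof.
move=> /asboolP cf /asboolP cg; apply: normed_cvg.
apply: (series_le_cvg _ _ _ (is_cvg_seriesD cf cg)) => n; first exact: normr_ge0.
  by apply: addr_ge0; exact: sqr_ge0.
have -> : ((fun n => normE2 (f n)) + (fun n => normE2 (g n))) n =
  normE2 (f n) + normE2 (g n) by [].
rewrite !normE2E /= qtr_qadjM ler_norml.
set a1 := complex.Re (qa (f n)); set a2 := complex.Im (qa (f n)).
set b1 := complex.Re (qb (f n)); set b2 := complex.Im (qb (f n)).
set c1 := complex.Re (qa (g n)); set c2 := complex.Im (qa (g n)).
set d1 := complex.Re (qb (g n)); set d2 := complex.Im (qb (g n)).
have sq (u v : R) : 0 <= u ^+ 2 + v ^+ 2 by apply: addr_ge0; exact: sqr_ge0.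
have [H1 H2] := (sq (a1 - c1) (a2 - c2), sq (a1 + c1) (a2 + c2)).
have H3 : 0 <= `|t| * ((b1 - d1) ^+ 2 + (b2 - d2) ^+ 2) by rewrite mulr_ge0.
have H4 : 0 <= `|t| * ((b1 + d1) ^+ 2 + (b2 + d2) ^+ 2) by rewrite mulr_ge0.
have [tE|tE] : `|t| = t \/ `|t| = - t.
- by case: (ger0P t) => _; [left|right].
- by move: H3 H4; rewrite tE => H3 H4; apply/andP; split; nra.
- by move: H3 H4; rewrite tE => H3 H4; apply/andP; split; nra.
Qed.

End Norms.

Section HardySpace.
Variables (R : realType) (t : R).

(* The nonvanishing of t is what makes normH2 a norm. *)
Record H2 (t0 : t != 0) := MkH2 {
  H2_coef :> nat -> Ht t;
  _ : H2_coef \in @square_summable R t }.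

Variable t0 : t != 0.
HB.instance Definition _ := [isSub for @H2_coef t0].
HB.instance Definition _ := [Choice of H2 t0 by <:].
HB.instance Definition _ := [SubChoice_isSubLmodule of H2 t0 by <:].

Fact H2_normD (f g : H2 t0) : normH2 (f + g) <= normH2 f + normH2 g.
Proof. by apply: normH2D; apply: valP. Qed.
Fact H2_normZ (r : R) (f : H2 t0) : normH2 (r *: f) = `|r| * normH2 f.
Proof. by apply: normH2Z; apply: valP. Qed.
Fact H2_norm_eq0 (f : H2 t0) : normH2 f = 0 -> f = 0.
Proof. by move=> f0; apply/val_inj/normH2_eq0 => //; apply: valP. Qed.
HB.instance Definition _ :=
  Lmodule_isNormed.Build R (H2 t0) H2_normD H2_normZ H2_norm_eq0.

Lemma H2_normE (f : H2 t0) : `|f| = normH2 f. Proof. by []. Qed.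

End HardySpace.

(* Main.v *)
(* Write a for alpha and a* for qadj alpha, and let h = (1 - q_t a* )^{-star} star f,
   so that f = h - q_t a* h and b_a star f = q_t h - a h.  Since a* is the adjoint
   of a for the form Tr(y* x) and a* a = a a* = det a, the partial sums of the
   Krein forms of the images and of the originals differ by the boundary term
   (det a - 1) Tr(k_N* h_N), which tends to 0.
   That h is square summable follows from h_(n+1) = a* h_n + f_(n+1) and
   the contraction of a* in a suitable norm: the operator norm bounds a on first
   columns, of squared norm |x|^2 + |y|^2 on qmx x y, and for the form above this
   norm is dual to the square root of |x|^2 + t^2 |y|^2, which a* contracts. *)

Require Import Defs.
From HB Require Import structures.
From mathcomp Require Import all_boot all_order all_algebra.
From mathcomp Require Import all_classical all_reals all_analysis.
From mathcomp Require Import complex.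
From mathcomp Require Import ring lra.

Set Implicit Arguments.
Unset Strict Implicit.
Unset Printing Implicit Defensive.

Import Order.TTheory GRing.Theory Num.Theory.
Import numFieldNormedType.Exports.
Local Open Scope classical_set_scope.
Local Open Scope ring_scope.
Local Open Scope complex_scope.

(** * The operator norm as a bound for the matrix action on vectors *)

Section OperatorNormTheory.
Variables (R : realType) (n : nat).
Implicit Types (A : 'M[R[i]]_n) (v : 'cV[R[i]]_n).

Lemma normc_ge0 (z : R[i]) : 0 <= Normc.normc z.
Proof. by case: z => a b; exact: sqrtr_ge0. Qed.

Lemma sqr_normc (z : R[i]) :
  Normc.normc z ^+ 2 = complex.Re z ^+ 2 + complex.Im z ^+ 2.
Proof. by case: z => a b /=; rewrite sqr_sqrtr// addr_ge0 ?sqr_ge0. Qed.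

Lemma normcR (r : R) : Normc.normc r%:C = `|r|.
Proof. by rewrite /= expr0n addr0 sqrtr_sqr. Qed.

Lemma ler_normc_sum (I : finType) (F : I -> R[i]) :
  Normc.normc (\sum_i F i) <= \sum_i Normc.normc (F i).
Proof.
apply: (big_ind2 (fun x y => Normc.normc x <= y)) => //.
  by rewrite Normc.normc0.
move=> x1 y1 x2 y2 h1 h2; apply: le_trans (lerD h1 h2).
exact: complex.le_normcD.
Qed.

Lemma sqr_l2norm v : l2norm v ^+ 2 = \sum_(i < n) Normc.normc (v i ord0) ^+ 2.
Proof. by rewrite sqr_sqrtr// sumr_ge0// => i _; exact: sqr_ge0. Qed.

Lemma l2normZ (r : R) v : l2norm (r%:C *: v) = `|r| * l2norm v.
Proof.
rewrite /l2norm -sqrtr_sqr -sqrtrM ?sqr_ge0//; congr Num.sqrt.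
rewrite mulr_sumr; apply: eq_bigr => i _.
by rewrite mxE Normc.normcM normcR exprMn real_normK ?num_real.
Qed.

Lemma normc_le_l2norm v i : Normc.normc (v i ord0) <= l2norm v.
Proof.
rewrite -(@ler_pXn2r _ 2)// ?nnegrE ?normc_ge0 ?sqrtr_ge0//.
by rewrite sqr_l2norm (bigD1 i)//= lerDl sumr_ge0// => j _; exact: sqr_ge0.
Qed.

Lemma l2norm_eq0 v : l2norm v = 0 -> v = 0.
Proof.
move=> v0; apply/matrixP => i j; rewrite ord1 mxE; apply: Normc.eq0_normc.
by apply/eqP; rewrite eq_le normc_ge0 andbT -v0; exact: normc_le_l2norm.
Qed.

(** Needed because [sup] takes a default value on unbounded sets. Entries of a vector of norm at
    most 1 have modulus at most 1, so the absolute row sums of [A] bound the entries of the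
    image. *)
Lemma opnorm_has_ubound A :
  has_ubound [set l2norm (A *m v) | v in [set v | l2norm v <= 1]].
Proof.
exists (Num.sqrt (\sum_(i < n) (\sum_(j < n) Normc.normc (A i j)) ^+ 2)).
move=> _ [v /= v1 <-]; apply: ler_wsqrtr; apply: ler_sum => i _.
rewrite ler_sqr ?nnegrE ?normc_ge0 ?sumr_ge0// => [|j _]; last exact: normc_ge0.
rewrite mxE; apply: (le_trans (ler_normc_sum _)).
apply: ler_sum => j _; rewrite Normc.normcM ler_piMr ?normc_ge0//.
exact: le_trans (normc_le_l2norm _ _) v1.
Qed.

Lemma l2norm0 : l2norm (0 : 'cV[R[i]]_n) = 0.
Proof. by have := l2normZ 0 0; rewrite scaler0 normr0 mul0r. Qed.

Lemma opnorm_ge0 A : 0 <= opnorm A.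
Proof.
apply: ub_le_sup; first exact: opnorm_has_ubound.
by exists 0; rewrite /= ?mulmx0 l2norm0.
Qed.

Lemma l2norm_mulmx A v : l2norm (A *m v) <= opnorm A * l2norm v.
Proof.
have [v0|v0] := eqVneq (l2norm v) 0.
  by rewrite (l2norm_eq0 v0) mulmx0 l2norm0 mulr0.
have v_gt0 : 0 < l2norm v by rewrite lt_def v0 sqrtr_ge0.
rewrite -ler_pdivrMr// mulrC -[(l2norm v)^-1]gtr0_norm ?invr_gt0// -l2normZ.
apply: ub_le_sup; first exact: opnorm_has_ubound.
exists ((l2norm v)^-1%:C *: v) => /=; last by rewrite scalemxAr.
by rewrite l2normZ gtr0_norm ?invr_gt0// mulVf.
Qed.

End OperatorNormTheory.

(** * Algebra of the star product and coefficients of [blaschke alpha] times a series *)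

Section CauchyProduct.
Variables (R : realType) (t : R).
Implicit Types (f g h : nat -> Ht t) (c : Ht t).

(** Coefficient [n] of a Cauchy product depends only on coefficients up to [n], so associativity can
    be borrowed from polynomials over [Ht t]. *)
Let trunc N f : {poly Ht t} := \poly_(i < N) f i.

Let pstar_trunc N f g n : (n < N)%N ->
  pstar f g n = (trunc N f * trunc N g)`_n.
Proof.
move=> nN; rewrite coefMr; apply: eq_bigr => k _.
rewrite !coef_poly (leq_ltn_trans (leq_subr _ _) nN).
by rewrite (leq_ltn_trans _ nN)// -ltnS.
Qed.

Lemma pstarA f g h : pstar f (pstar g h) = pstar (pstar f g) h.
Proof.
apply/funext => n; pose T := trunc n.+1.
transitivity (T f * T g * T h)`_n; first rewrite -mulrA.
  rewrite coefMr; apply: eq_bigr => k _.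
  by rewrite coef_poly ltnS leq_subr (@pstar_trunc n.+1).
rewrite coefMr; apply: eq_bigr => k _.
by rewrite coef_poly ltn_ord (@pstar_trunc n.+1)// ltnS leq_subr.
Qed.

Lemma pstarDr f g h : pstar f (g + h) = pstar f g + pstar f h.
Proof.
apply/funext => n; rewrite /= -[RHS]/(pstar f g n + pstar f h n) -big_split.
by apply: eq_bigr => k _; rewrite /= -mulrDr.
Qed.

Lemma pstarZr f (r : R) g : pstar f (r *: g) = r *: pstar f g.
Proof.
apply/funext => n; rewrite -[RHS]/(r *: pstar f g n) scaler_sumr.
by apply: eq_bigr => k _; rewrite -scalerAr.
Qed.

Lemma pstarBl f g h n : pstar (f - g) h n = pstar f h n - pstar g h n.
Proof.
by rewrite -sumrB; apply: eq_bigr => k _; rewrite -mulrBl.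
Qed.

Lemma pstar_pconst c f n : pstar (pconst c) f n = c * f n.
Proof.
rewrite /pstar big_ord_recr /= subnn /pconst big1 ?add0r// => k _.
by rewrite subn_eq0 leqNgt ltn_ord mul0r.
Qed.

Lemma pstar_plin0 c f : pstar (plin c) f 0 = 0.
Proof. by rewrite /pstar big_ord1 /plin mul0r. Qed.

Lemma pstar_plinS c f n : pstar (plin c) f n.+1 = c * f n.
Proof.
rewrite /pstar !big_ord_recr /= subnn subSnn /plin /= mul0r addr0.
rewrite big1 ?add0r// => k _.
by rewrite subSn 1?ltnW// eqSS subn_eq0 leqNgt ltn_ord mul0r.
Qed.

(** The series [h] of the overview. *)
Definition resolvent alpha f := pstar (pstar_inv (pconst 1 - plin (qadj alpha))) f.

Lemma resolventK alpha f :
  pstar (pconst 1 - plin (qadj alpha)) (resolvent alpha f) = f.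
Proof.
rewrite /resolvent pstarA (blaschke_invP alpha).1.
by apply/funext => n; rewrite pstar_pconst mul1r.
Qed.

Lemma resolvent0 alpha f : resolvent alpha f 0 = f 0.
Proof.
by rewrite -{2}(resolventK alpha f) pstarBl pstar_pconst pstar_plin0 mul1r subr0.
Qed.

Lemma resolventS alpha f n :
  resolvent alpha f n.+1 = qadj alpha * resolvent alpha f n + f n.+1.
Proof.
rewrite -{3}(resolventK alpha f) pstarBl pstar_pconst pstar_plinS mul1r.
by rewrite addrC subrK.
Qed.

Lemma blaschke_resolvent alpha f : pstar (blaschke alpha) f =
  pstar (plin 1 - pconst alpha) (resolvent alpha f).
Proof. by rewrite pstarA. Qed.

Lemma blaschke0 alpha f :
  pstar (blaschke alpha) f 0 = - (alpha * resolvent alpha f 0).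
Proof.
by rewrite blaschke_resolvent pstarBl pstar_pconst pstar_plin0 sub0r.
Qed.

Lemma blaschkeS alpha f n : pstar (blaschke alpha) f n.+1 =
  resolvent alpha f n - alpha * resolvent alpha f n.+1.
Proof.
by rewrite blaschke_resolvent pstarBl pstar_pconst pstar_plinS mul1r.
Qed.

End CauchyProduct.

(** * The indefinite form on coefficients and the weighted norms compared with it *)

Section KreinForm.
Variables (R : realType) (t : R).
Implicit Types (x y alpha : Ht t) (w : R).

Lemma qaM x y : qa (x * y) = qa x * qa y + t%:C * qb x * conjc (qb y).
Proof. by rewrite {1}(qtE x) {1}(qtE y) /qa /= qmxM mxE. Qed.

Lemma qbM x y : qb (x * y) = qa x * qb y + qb x * conjc (qa y).
Proof. by rewrite {1}(qtE x) {1}(qtE y) /qb /= qmxM mxE /= conjcK. Qed.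

Lemma qa_adj x : qa (qadj x) = conjc (qa x).
Proof. by rewrite /qa mxE. Qed.

Lemma qb_adj x : qb (qadj x) = - qb x.
Proof. by rewrite /qb mxE /= conjcK. Qed.

(** The determinant of the matrix, which is real; [qadj] is the adjugate, so [qadj x * x] is this
    scalar. *)
Definition qdet x : R :=
  complex.Re (qa x) ^+ 2 + complex.Im (qa x) ^+ 2
  - t * (complex.Re (qb x) ^+ 2 + complex.Im (qb x) ^+ 2).

Lemma qdet_adj x : qdet (qadj x) = qdet x.
Proof.
rewrite /qdet qa_adj qb_adj.
by case: (qa x) (qb x) => a1 a2 [b1 b2] /=; ring.
Qed.

Definition qform x y : R := qtr (qadj y * x).

Lemma qformBl x y z : qform (x - y) z = qform x z - qform y z.
Proof. by rewrite /qform mulrBr /qtr /= raddfB /= raddfB. Qed.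

Lemma qformC x y : qform x y = qform y x.
Proof. rewrite /qform !qtr_qadjM; ring. Qed.

Lemma qformBr x y z : qform x (y - z) = qform x y - qform x z.
Proof. by rewrite qformC qformBl !(qformC x). Qed.

Lemma qform0l y : qform 0 y = 0.
Proof. by rewrite -(subrr (0 : Ht t)) qformBl subrr. Qed.

Lemma qform_adj alpha x y : qform (alpha * x) y = qform x (qadj alpha * y).
Proof.
rewrite /qform !qtr_qadjM !(qaM, qbM) qa_adj qb_adj.
case: (qa x) (qb x) (qa y) (qb y) (qa alpha) (qb alpha)
  => x1 x2 [x3 x4] [y1 y2] [y3 y4] [a1 a2] [a3 a4] /=.
ring.
Qed.

Lemma qform_mul alpha x y :
  qform (alpha * x) (alpha * y) = qdet alpha * qform x y.
Proof.
rewrite /qform !qtr_qadjM !(qaM, qbM) /qdet.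
case: (qa x) (qb x) (qa y) (qb y) (qa alpha) (qb alpha)
  => x1 x2 [x3 x4] [y1 y2] [y3 y4] [a1 a2] [a3 a4] /=.
ring.
Qed.

Lemma qadjK : involutive (@qadj R t).
Proof. by move=> x; rewrite (qtE x) /qadj qa_adj qb_adj conjcK opprK -qtE. Qed.

(** Moving [alpha] across the form by its adjoint makes the mixed terms of both expansions agree;
    only the diagonal terms survive, with weights 1 and [qdet alpha]. *)
Lemma qform_blaschke_step alpha x0 x1 y0 y1 :
  qform (x0 - alpha * x1) (y0 - alpha * y1) -
  qform (x1 - qadj alpha * x0) (y1 - qadj alpha * y0) =
  (1 - qdet alpha) * (qform x0 y0 - qform x1 y1).
Proof.
rewrite !(qformBl, qformBr) !qform_mul qdet_adj !qform_adj qadjK.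
ring.
Qed.

(** Weight [|t|] gives the squared [normE], weight 1 the squared length of the first column, and
    weight [t ^+ 2] the squared norm dual to the latter. *)
Definition wnorm2 w x : R :=
  complex.Re (qa x) ^+ 2 + complex.Im (qa x) ^+ 2
  + w * (complex.Re (qb x) ^+ 2 + complex.Im (qb x) ^+ 2).

Lemma normE2_wnorm2 x : normE x ^+ 2 = wnorm2 `|t| x.
Proof. exact: normE2E. Qed.

Lemma wnorm2_ge0 w x : 0 <= w -> 0 <= wnorm2 w x.
Proof. by move=> w0; rewrite addr_ge0 ?mulr_ge0 ?addr_ge0 ?sqr_ge0. Qed.

Lemma wnorm2_le w w' x : 0 <= w -> 0 < w' ->
  wnorm2 w x <= (1 + w / w') * wnorm2 w' x.
Proof.
move=> w0 w'0; rewrite -subr_ge0 /wnorm2.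
set a := complex.Re (qa x) ^+ 2 + _; set b := complex.Re (qb x) ^+ 2 + _.
have a0 : 0 <= a by rewrite addr_ge0 ?sqr_ge0.
have b0 : 0 <= b by rewrite addr_ge0 ?sqr_ge0.
have -> : (1 + w / w') * (a + w' * b) - (a + w * b) = w / w' * a + w' * b.
  by field; rewrite gt_eqF.
by rewrite addr_ge0 ?mulr_ge0 ?invr_ge0 ?(ltW w'0).
Qed.

(** Young's inequality: the difference of the two sides is a weighted sum of squares. The free [l]
    lets the factor on [x] be as close to 1 as desired. *)
Lemma wnorm2D w l x y : 0 <= w -> 0 < l ->
  wnorm2 w (x + y) <= (1 + l) * wnorm2 w x + (1 + l^-1) * wnorm2 w y.
Proof.
move=> w0 l0; rewrite -subr_ge0 /wnorm2 qaD qbD.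
case: (qa x) (qb x) (qa y) (qb y) => a1 a2 [a3 a4] [b1 b2] [b3 b4] /=.
have E (u v : R) : (1 + l) * u ^+ 2 + (1 + l^-1) * v ^+ 2 - (u + v) ^+ 2
    = l * (u - l^-1 * v) ^+ 2 by field; rewrite gt_eqF.
have -> : (1 + l) * (a1 ^+ 2 + a2 ^+ 2 + w * (a3 ^+ 2 + a4 ^+ 2)) +
  (1 + l^-1) * (b1 ^+ 2 + b2 ^+ 2 + w * (b3 ^+ 2 + b4 ^+ 2)) -
  ((a1 + b1) ^+ 2 + (a2 + b2) ^+ 2 + w * ((a3 + b3) ^+ 2 + (a4 + b4) ^+ 2)) =
  l * (a1 - l^-1 * b1) ^+ 2 + l * (a2 - l^-1 * b2) ^+ 2 +
  w * (l * (a3 - l^-1 * b3) ^+ 2 + l * (a4 - l^-1 * b4) ^+ 2).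
  rewrite -!E; ring.
have sq (u : R) : 0 <= l * u ^+ 2 by rewrite mulr_ge0 ?sqr_ge0 ?ltW.
by rewrite !addr_ge0// mulr_ge0// addr_ge0.
Qed.

(** Completing squares: the difference is the sum of the squared moduli of [qa x - qa y] and
    [qb x + t qb y]. *)
Lemma qform_le x y : qform x y <= wnorm2 1 x + wnorm2 (t ^+ 2) y.
Proof.
rewrite /qform qtr_qadjM /wnorm2.
case: (qa x) (qb x) (qa y) (qb y) => a1 a2 [a3 a4] [b1 b2] [b3 b4] /=.
rewrite -subr_ge0.
set d := (X in 0 <= X).
have -> : d = (a1 - b1) ^+ 2 + (a2 - b2) ^+ 2 + (a3 + t * b3) ^+ 2
              + (a4 + t * b4) ^+ 2 by rewrite /d; ring.
by rewrite !addr_ge0 ?sqr_ge0.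
Qed.

(* wnorm2 1 and wnorm2 (t ^+ 2) are dual with respect to qform, for which
   multiplication by qadj alpha is adjoint to multiplication by alpha. *)
Lemma wnorm2_qadjM rho alpha y : rho < 2 ->
  (forall x, wnorm2 1 (alpha * x) <= rho * wnorm2 1 x) ->
  wnorm2 (t ^+ 2) (qadj alpha * y) <= (2 - rho)^-1 * wnorm2 (t ^+ 2) y.
Proof.
move=> rho2 H; set z := qadj alpha * y.
(* The vector for which [qform_le] at [x], [z] is an equality. Pairing [alpha * x] with [y] then
   gives [2 W(z) <= rho W(z) + W(y)], where [W] is [wnorm2 (t ^+ 2)]. *)
pose x := qt t (qa z) (- (t%:C * qb z)).
have xa : qa x = qa z by rewrite /qa mxE.
have xb : qb x = - (t%:C * qb z) by rewrite /qb mxE /= conjcK.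
have xz : qform x z = 2 * wnorm2 (t ^+ 2) z.
  rewrite /qform qtr_qadjM /wnorm2 xa xb.
  by case: (qa z) (qb z) => a1 a2 [b1 b2] /=; ring.
have xN : wnorm2 1 x = wnorm2 (t ^+ 2) z.
  rewrite /wnorm2 xa xb.
  by case: (qa z) (qb z) => a1 a2 [b1 b2] /=; ring.
have := qform_le (alpha * x) y; rewrite qform_adj -/z xz.
have := H x; rewrite xN => h1 h2.
rewrite mulrC ler_pdivlMr ?subr_gt0//; lra.
Qed.

(** The first column of [alpha * x] is [alpha] applied to the first column of [x]. *)
Lemma wnorm2_opnorm alpha x :
  wnorm2 1 (alpha * x) <= opnorm alpha ^+ 2 * wnorm2 1 x.
Proof.
have E y : wnorm2 1 y = l2norm (col ord0 (y : 'M[R[i]]_2)) ^+ 2.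
  rewrite sqr_l2norm big_ord_recl big_ord1 !sqr_normc /wnorm2 /qa /qb !mxE.
  rewrite (_ : lift ord0 ord0 = 1); last exact: val_inj.
  by case: ((y : 'M[R[i]]_2) 0 0) ((y : 'M[R[i]]_2) 1 0) => a1 a2 [b1 b2] /=; ring.
rewrite !E -exprMn ler_sqr ?nnegrE ?mulr_ge0 ?opnorm_ge0 ?sqrtr_ge0//.
have -> : col ord0 (alpha * x : Ht t) = (alpha : 'M[R[i]]_2) *m col ord0 (x : 'M[R[i]]_2).
  by rewrite !colE mulmxA.
exact: l2norm_mulmx.
Qed.

End KreinForm.

(** * Summability estimates and the telescoping of the Krein form *)

Section SquareSummable.
Variables (R : realType) (t : R) (t0 : t != 0).
Implicit Types (f g : nat -> Ht t) (alpha x : Ht t).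

(** Summing the recurrence bounds a partial sum of [u] by [s] times the previous one plus [K] times
    that of [v]. Since [u] is nonnegative, the previous sum is at most the current one and is
    absorbed on the left. *)
Lemma series_contraction_le (s K : R) (u v : R ^nat) : 0 <= s < 1 ->
  (forall n, 0 <= u n) -> u 0%N <= K * v 0%N ->
  (forall n, u n.+1 <= s * u n + K * v n.+1) ->
  forall N, series u N <= K / (1 - s) * series v N.
Proof.
move=> /andP[s0 s1] u0 uv0 uvS N.
have uN k : 0 <= u k /\ 0 <= series u k.
  by split=> //; rewrite /series /= sumr_ge0.
have H k : series u k.+1 <= s * series u k + K * series v k.+1.
  elim: k => [|k IH].
    by rewrite /series /= !big_nat1 big_geq// mulr0 add0r.
  rewrite /series /= (big_nat_recr k.+1)//= [X in s * X](big_nat_recr k)//=.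
  rewrite [X in K * X](big_nat_recr k.+1)//=.
  rewrite mulrDr mulrDr addrACA; exact: lerD.
rewrite mulrAC ler_pdivlMr ?subr_gt0//.
case: N => [|N].
  by rewrite /series /= !big_geq// mul0r mulr0.
have := H N; have : series u N <= series u N.+1.
  by rewrite /series /= big_nat_recr//= lerDl.
move/(ler_wpM2l s0); lra.
Qed.

Lemma square_summable_le (C : R) f g : 0 <= C ->
  (forall N, series (fun n => normE (g n) ^+ 2) N <=
             C * series (fun n => normE (f n) ^+ 2) N) ->
  f \in @square_summable R t ->
  g \in @square_summable R t /\ normH2 g <= Num.sqrt C * normH2 f.
Proof.
move=> C0 H sf; have /asboolP cf := sf.
have ndg : nondecreasing_seq (series (fun n => normE (g n) ^+ 2)).
  by apply/nondecreasing_seqP => k; rewrite /series /= big_nat_recr//= lerDl sqr_ge0.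
have ndf : nondecreasing_seq (series (fun n => normE (f n) ^+ 2)).
  by apply/nondecreasing_seqP => k; rewrite /series /= big_nat_recr//= lerDl sqr_ge0.
have le_lim N : series (fun n => normE (g n) ^+ 2) N <=
    C * limn (series (fun n => normE (f n) ^+ 2)).
  apply: le_trans (H N) _; apply: ler_wpM2l => //.
  exact: nondecreasing_cvgn_le.
have cg : cvgn (series (fun n => normE (g n) ^+ 2)).
  apply: nondecreasing_is_cvgn => //.
  by exists (C * limn (series (fun n => normE (f n) ^+ 2))) => _ [N _ <-].
split; first by rewrite square_summableP; apply/asboolP.
rewrite /normH2 -sqrtrM//; apply: ler_wsqrtr.
by apply: limr_le => //; near=> N; exact: le_lim.
Unshelve. all: end_near. Qed.

Lemma seriesZ_le (c : R) (u v : R ^nat) N : (forall n, u n <= c * v n) ->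
  series u N <= c * series v N.
Proof. by move=> uv; rewrite /series /= mulr_sumr; exact: ler_sum. Qed.

Lemma resolvent_series_le alpha : opnorm alpha < 1 ->
  exists2 C : R, 0 <= C & forall f N,
    series (fun n => normE (resolvent alpha f n) ^+ 2) N <=
    C * series (fun n => normE (f n) ^+ 2) N.
Proof.
move=> alpha1; set rho := opnorm alpha ^+ 2.
have rho0 : 0 <= rho by exact: sqr_ge0.
have rho1 : rho < 1 by rewrite expr_lt1 ?opnorm_ge0.
have t_gt0 : 0 < `|t| by rewrite normr_gt0.
have t2_gt0 : 0 < t ^+ 2 by rewrite exprn_even_gt0.
(* The contraction factor from [wnorm2_qadjM]; it is below 1 because [rho] is. *)
set sigma := (2 - rho)^-1.
have sigma0 : 0 < sigma by rewrite invr_gt0; lra.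
have sigma1 : sigma < 1 by rewrite invf_lt1; lra.
pose W := @wnorm2 R t (t ^+ 2).
have W0 x : 0 <= W x by rewrite wnorm2_ge0 ?ltW.
have WD l x y : 0 < l -> W (x + y) <= (1 + l) * W x + (1 + l^-1) * W y.
  by apply: wnorm2D; exact: ltW.
have Wadj x : W (qadj alpha * x) <= sigma * W x.
  by apply: wnorm2_qadjM => [|y]; [lra | exact: wnorm2_opnorm].
have [B B0 WE] : exists2 B, 0 <= B & forall x, W x <= B * normE x ^+ 2.
  exists (1 + t ^+ 2 / `|t|) => [|x].
    by rewrite addr_ge0 ?divr_ge0 ?(ltW t2_gt0).
  by rewrite normE2_wnorm2; apply: wnorm2_le => //; exact: ltW.
have [D D0 EW] : exists2 D, 0 <= D & forall x, normE x ^+ 2 <= D * W x.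
  exists (1 + `|t| / t ^+ 2) => [|x].
    by rewrite addr_ge0 ?divr_ge0 ?(ltW t2_gt0).
  by rewrite normE2_wnorm2; apply: wnorm2_le.
clearbody W.
(* Small enough that Young's inequality keeps a contraction: [1 - (1 + l) * sigma] equals
   [(1 - sigma) * (2 - sigma) / 2]. *)
pose l := (1 - sigma) / 2; have l0 : 0 < l by rewrite /l; lra.
pose s := (1 + l) * sigma.
have s01 : 0 <= s < 1 by apply/andP; split; rewrite /s /l; nra.
pose K := 1 + l^-1.
have K1 : 1 <= K by rewrite lerDl invr_ge0 ltW.
pose L := K / (1 - s).
have L0 : 0 <= L by have [_ s1] := andP s01; apply: divr_ge0; lra.
have W_le f N : series (fun n => W (resolvent alpha f n)) N <=
    L * series (fun n => W (f n)) N.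
  apply: series_contraction_le => // [|n].
    by rewrite resolvent0 ler_peMl.
  rewrite resolventS; apply: le_trans (WD _ _ _ l0) _.
  rewrite -/K lerD2r /s -mulrA; apply: ler_wpM2l => //; lra.
exists (D * (L * B)) => [|f N]; first by apply: mulr_ge0 => //; exact: mulr_ge0.
rewrite -[leRHS]mulrA; apply: le_trans (seriesZ_le _ (fun n => EW _)) _.
apply: ler_wpM2l => //; apply: le_trans (W_le _ _) _.
rewrite -[leRHS]mulrA ler_wpM2l//.
by apply: seriesZ_le => n; exact: WE.
Qed.

(** Passing to weight 1, where [alpha] contracts, and back to weight [|t|] costs only constants. *)
Lemma normE2_mul_le alpha : opnorm alpha < 1 ->
  exists2 A : R, 0 <= A & forall x, normE (alpha * x) ^+ 2 <= A * normE x ^+ 2.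
Proof.
move=> alpha1; have t_gt0 : 0 < `|t| by rewrite normr_gt0.
exists ((1 + `|t| / 1) * (1 + 1 / `|t|)) => [|x].
  by rewrite mulr_ge0 ?addr_ge0 ?divr_ge0 ?ler01.
rewrite !normE2_wnorm2; apply: le_trans (wnorm2_le _ (normr_ge0 t) ltr01) _.
rewrite -[leRHS]mulrA ler_wpM2l ?addr_ge0 ?divr_ge0//.
apply: le_trans (wnorm2_le _ ler01 t_gt0).
apply: le_trans (wnorm2_opnorm _ _) _.
by rewrite ler_piMl ?wnorm2_ge0// expr_le1 ?opnorm_ge0// ltW.
Qed.

Lemma blaschke_series_le alpha : opnorm alpha < 1 ->
  exists2 C : R, 0 <= C & forall f N,
    series (fun n => normE (pstar (blaschke alpha) f n) ^+ 2) N <=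
    C * series (fun n => normE (resolvent alpha f n) ^+ 2) N.
Proof.
move=> /normE2_mul_le[A A0 EM]; exists (2 * (A + 1)) => [|f N].
  by rewrite mulr_ge0 ?addr_ge0.
pose E (x : Ht t) := normE x ^+ 2; set h := resolvent alpha f.
rewrite -/(E _); have E0 x : 0 <= E x by exact: sqr_ge0.
have EN x : E (- x) = E x by rewrite /E -scaleN1r normE2Z sqrrN expr1n mul1r.
have SR (u : R ^nat) p : series u p.+1 = series u p + u p.
  by rewrite /series /= big_nat_recr.
have ED := @normE2D R t 1; move: EM ED; rewrite -/E => EM ED.
(* Coefficient [n.+1] of the image is [h n - alpha * h n.+1], hence the second sum lags by one
   index; each factor 2 is [normE2D] with [l = 1]. *)
have H m : series (fun n => E (pstar (blaschke alpha) f n)) m.+1 <=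
    2 * A * series (fun n => E (h n)) m.+1 + 2 * series (fun n => E (h n)) m.
  elim: m => [|m IH].
    rewrite /series /= !big_nat1 big_geq// mulr0 addr0 blaschke0 EN -/h.
    by have := EM (h 0); have := mulr_ge0 A0 (E0 (h 0)); rewrite /E; lra.
  rewrite SR [series _ m.+2]SR [in X in _ <= _ + X]SR blaschkeS -/h.
  have := ED (h m) (- (alpha * h m.+1)) ltr01.
  rewrite -!/(E _) EN invr1; have := EM (h m.+1); rewrite -!/(E _); lra.
case: N => [|N]; first by rewrite /series /= !big_geq// mulr0.
apply: le_trans (H N) _.
have : series (fun n => E (h n)) N <= series (fun n => E (h n)) N.+1.
  by rewrite SR lerDl.
by rewrite -/(E _); lra.
Qed.

Lemma krein_form_blaschke alpha f g :
  f \in @square_summable R t -> g \in @square_summable R t ->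
  resolvent alpha f \in @square_summable R t ->
  resolvent alpha g \in @square_summable R t ->
  krein_form (pstar (blaschke alpha) f) (pstar (blaschke alpha) g) =
  krein_form f g.
Proof.
move=> sf sg sh sk; set h := resolvent alpha f; set k := resolvent alpha g.
pose c n := - (1 - qdet alpha) * qform (h n) (k n).
(* Telescoping: the first [N] terms leave the boundary term at index [N - 1], and none when
   [N = 0]. *)
have E : series (fun n => qform (pstar (blaschke alpha) f n)
                                (pstar (blaschke alpha) g n)) =
    fun N => series (fun n => qform (f n) (g n)) N +
             (if N is m.+1 then c m else 0).
  apply/funext => -[|N]; first by rewrite /series /= !big_geq// addr0.
  elim: N => [|N IH].
    rewrite /series /= !big_nat1 !blaschke0 -/h -/k.
    (* Index 0 is the general step with vanishing previous coefficients, as [h 0 = f 0] and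
       [k 0 = g 0]. *)
    have := qform_blaschke_step alpha 0 (h 0) 0 (k 0).
    rewrite !sub0r !mulr0 !subr0 qform0l /c {2}/h {2}/k !resolvent0.
    move/eqP; rewrite subr_eq => /eqP ->; ring.
  rewrite /series /= big_nat_recr//= -[X in X + _]/(series _ N.+1) IH.
  rewrite [in RHS]big_nat_recr//=.
  have fE (u : nat -> Ht t) : u N.+1 =
      resolvent alpha u N.+1 - qadj alpha * resolvent alpha u N.
    by rewrite resolventS addrC addKr.
  rewrite !blaschkeS [in RHS](fE f) [in RHS](fE g) -/h -/k.
  have := qform_blaschke_step alpha (h N) (h N.+1) (k N) (k N.+1).
  move/eqP; rewrite subr_eq => /eqP ->.
  rewrite /c /series /=; ring.
rewrite /krein_form -/qform.
transitivity (limn (fun N => series (fun n => qform (f n) (g n)) N +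
             (if N is m.+1 then c m else 0))); first by rewrite -E.
apply/cvg_lim => //; rewrite -[X in _ --> X]addr0.
(* The boundary terms are multiples of the terms of the convergent series for [krein_form h k]. *)
have c0 : c @ \oo --> (0 : R).
  have := cvgM (cvg_cst (- (1 - qdet alpha)))
               (cvg_series_cvg_0 (krein_form_cvg sh sk)).
  by rewrite mulr0; apply.
have c'0 : (fun N => if N is m.+1 then c m else 0) @ \oo --> (0 : R).
  by rewrite -cvg_shiftS.
exact: cvgD (krein_form_cvg sf sg) c'0.
Qed.

End SquareSummable.

(** * The multiplication operator on [H2 t0] and its continuity *)

Section BlaschkeMultiplication.
Variables (R : realType) (t : R) (t0 : t != 0) (alpha : Ht t).
Hypothesis alpha1 : opnorm alpha < 1.
Implicit Types f : nat -> Ht t.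

Lemma resolvent_square_summable f : f \in @square_summable R t ->
  resolvent alpha f \in @square_summable R t.
Proof.
have [C C0 H] := resolvent_series_le t0 alpha1.
by move=> /(square_summable_le C0 (H f))[].
Qed.

Lemma blaschke_bounded : exists C : R, forall f, f \in @square_summable R t ->
  pstar (blaschke alpha) f \in @square_summable R t /\
  normH2 (pstar (blaschke alpha) f) <= C * normH2 f.
Proof.
have [C C0 HC] := resolvent_series_le t0 alpha1.
have [D D0 HD] := blaschke_series_le t0 alpha1.
exists (Num.sqrt (D * C)) => f; apply: square_summable_le => [|N].
  exact: mulr_ge0.
apply: le_trans (HD f N) _; rewrite -[leRHS]mulrA ler_wpM2l//; exact: HC.
Qed.

Fact blaschke_square_summable (f : H2 t0) :
  pstar (blaschke alpha) f \in @square_summable R t.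
Proof. by have [C /(_ f (valP f))[]] := blaschke_bounded. Qed.

Definition blaschke_mul (f : H2 t0) : H2 t0 :=
  MkH2 t0 (blaschke_square_summable f).

Fact blaschke_mul_linear : linear blaschke_mul.
Proof.
by move=> r f g; apply: val_inj; rewrite /= pstarDr pstarZr.
Qed.
HB.instance Definition _ := GRing.isLinear.Build R (H2 t0) (H2 t0) *:%R
  blaschke_mul blaschke_mul_linear.

Lemma blaschke_mul_continuous : continuous blaschke_mul.
Proof.
have [C HC] := blaschke_bounded.
apply/linear_bounded_continuous/linear_boundedP.
(* Boundedness is asked for all large [r]; every [r] above [C] will do. *)
near=> r => f; apply: (@le_trans _ _ (C * `|f|)).
  exact: (HC f (valP f)).2.
by apply: ler_wpM2r => //; near: r; apply: nbhs_pinfty_ge; exact: num_real.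
Unshelve. all: end_near. Qed.

End BlaschkeMultiplication.

Theorem theorem4p10 (R : realType) (t : R) (t0 : t != 0) (alpha : Ht t)
    (halpha : opnorm alpha < 1) :
  exists M : {linear H2 t0 -> H2 t0},
    [/\ forall f : H2 t0, M f = pstar (blaschke alpha) f :> (nat -> Ht t),
        continuous M
      & forall f g : H2 t0, krein_form (M f) (M g) = krein_form f g].
Proof.
exists (@blaschke_mul R t t0 alpha halpha); split.
- by [].
- exact: blaschke_mul_continuous.
- move=> f g.
  have ss h := resolvent_square_summable t0 halpha (valP (h : H2 t0)).
  exact: krein_form_blaschke (valP f) (valP g) (ss f) (ss g).
Qed.
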